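(* Let $n_1,n_2\ge 3$ be integers with $n_1\mid n_2$. Then the critical group $K(C_4\times C_{n_1})$ is (isomorphic to) a subgroup of the critical group $K(C_4\times C_{n_2})$.
   Context: For a finite connected graph $G=(V,E)$, the Laplacian $L(G)$ is the $|V|\times|V|$ integer matrix with $L_{uu}=\deg(u)$ and $L_{uv}=-(\text{number of edges joining }u,v)$ for $u\ne v$. If the Smith normal form of $L(G)$ is $\mathrm{diag}(t_1,\dots,t_{|V|-1},0)$, the critical group is $K(G)=\bigoplus_{i=1}^{|V|-1}\mathbb{Z}/t_i\mathbb{Z}$. $C_n$ denotes the cycle on $n$ vertices and $C_4\times C_n$ the Cartesian product graph (vertices $(u,v)$, with $(u_1,v_1)\sim(u_2,v_2)$ iff $u_1=u_2$ and $v_1\sim v_2$, or $u_1\sim u_2$ and $v_1=v_2$). *)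

(* Defs.v *)
From HB Require Import structures.
From mathcomp Require Import all_boot all_order all_algebra all_fingroup.

Set Implicit Arguments.
Unset Strict Implicit.
Unset Printing Implicit Defensive.

Import Order.TTheory GRing.Theory Num.Theory.
Local Open Scope ring_scope.

Section Laplacian.

(* A finite loopless multigraph on V is given by its edge multiplicities:
   m u v is the number of edges joining u and v. *)
Variables (V : finType) (m : V -> V -> nat).

Definition degree (u : V) : nat := (\sum_v m u v)%N.

Definition laplacian : 'M[int]_#|V| :=
  \matrix_(i, j)
    if i == j then (degree (enum_val i))%:Z
    else - (m (enum_val i) (enum_val j))%:Z.

(* The diagonal of the Smith normal form provided by the library. Its entries
   form a divisibility chain but are only determined up to sign, and trailing
   zeroes may be omitted from the list. *)
Definition smith_diag (p q : nat) (M : 'M[int]_(p, q)) : seq int :=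
  let: existT2 _ _ (existT2 _ _ (exist2 d _ _)) := int_Smith_normal_form M in d.

Definition smith_factor (i : nat) : nat := absz (smith_diag laplacian)`_i.

(* 'I_k.+1 carries the additive group structure of Z/(k+1)Z. It is used instead
   of 'Z_t because 'Z_1 is not trivial. The case t = 0 does not occur for a
   connected graph, see smith_factor_gt0. *)
Definition cyclic_group (t : nat) : finGroupType := 'I_t.-1.+1.

(* The external direct product of the Z/t_i, omitting the last diagonal entry,
   which is zero for a connected graph. *)
Definition critical_group : finGroupType :=
  {dffun forall i : 'I_#|V|.-1, cyclic_group (smith_factor i)}.

End Laplacian.

Definition simple_mult (V : finType) (e : rel V) (u v : V) : nat := e u v.

(* Simple for n >= 3. *)
Definition cycle_graph (n : nat) : rel 'I_n :=
  fun i j => (j == ordS i) || (i == ordS j).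

Definition cartesian_product (V1 V2 : finType) (e1 : rel V1) (e2 : rel V2) :
    rel (V1 * V2)%type :=
  fun x y => (x.1 == y.1) && e2 x.2 y.2 || e1 x.1 y.1 && (x.2 == y.2).

Definition torus_critical_group (n : nat) : finGroupType :=
  critical_group (simple_mult (cartesian_product (@cycle_graph 4) (@cycle_graph n))).

Lemma smith_diag_spec (p q : nat) (M : 'M[int]_(p, q)) :
  sorted dvdz (smith_diag M) /\
  exists2 A, A \in unitmx & exists2 B, B \in unitmx &
    M = A *m (\matrix_(i, j) ((smith_diag M)`_i *+ (i == j :> nat))) *m B.
Proof.
rewrite /smith_diag; case: int_Smith_normal_form => A uA [B uB [d sd eM]].
by split=> //; exists A => //; exists B.
Qed.

Lemma smith_diag_dvd (p q : nat) (M : 'M[int]_(p, q)) (i j : nat) :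
  (i <= j)%N -> ((smith_diag M)`_i %| (smith_diag M)`_j)%Z.
Proof.
have [sd _] := smith_diag_spec M; move: (smith_diag M) sd => d sd leij.
have [ltj|lej] := ltnP j (size d); last by rewrite (nth_default 0 lej) dvdz0.
have := sorted_leq_nth _ _ 0 sd => H; apply: H => //.
- by move=> a b c; exact: dvdz_trans.
- by move=> a; exact: dvdzz.
- by rewrite inE (leq_ltn_trans leij).
Qed.

Section Connected.

Variables (V : finType) (m : V -> V -> nat).
Hypothesis m_sym : forall u v, m u v = m v u.
Hypothesis m_loopless : forall u, m u u = 0%N.
Hypothesis m_connected : forall u v, connect (fun x y => (0 < m x y)%N) u v.

Lemma laplacian_kernel (x : 'rV[int]_#|V|) :
  x *m laplacian m = 0 -> forall i j, x 0 i = x 0 j.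
Proof.
move=> x0 i j; pose f u := x 0 (enum_rank u).
have harm v : \sum_u (m u v)%:Z * (f v - f u) = 0.
  have /rowP/(_ (enum_rank v)) := x0; rewrite !mxE.
  rewrite (reindex enum_rank) /=; last first.
    by exists enum_val => ? _; rewrite (enum_rankK, enum_valK).
  rewrite (bigD1 v) //= mxE eqxx !enum_rankK => e0.
  rewrite -[RHS]e0; under eq_bigr do rewrite mulrBr.
  rewrite sumrB -mulr_suml (bigD1 v (P := xpredT)
    (F := fun u => (m u v)%:Z * f u)) //= m_loopless mul0r add0r.
  congr (_ + _).
    rewrite mulrC /degree; congr (_ * _).
    rewrite (big_morph Posz PoszD (erefl _)).
    by apply: eq_bigr => u _; rewrite m_sym.
  rewrite -sumrN; apply: eq_bigr => u /negPf uv.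
  by rewrite mxE (inj_eq enum_rank_inj) uv !enum_rankK mulrN mulrC.
have [w _ wmax] := @arg_maxP _ _ _ (enum_val i) xpredT f isT.
have step u v : (0 < m u v)%N -> f u = f w -> f v = f w.
  move=> muv fu; have /eqP := harm u; rewrite psumr_eq0; last first.
    by move=> y _; rewrite mulr_ge0 // subr_ge0 fu; exact: wmax.
  move=> /allP/(_ v); rewrite mem_index_enum => /(_ isT) /=.
  by rewrite mulf_eq0 subr_eq0 m_sym eqz_nat eqn0Ngt muv /= fu => /eqP.
have const u : f u = f w.
  have /connectP[p] := m_connected w u.
  have : f w = f w by [].
  elim: p {1 3 4}w => [|y p IH] z fz /=; first by move=> _ ->.
  by case/andP=> /step/(_ fz) fy /IH; apply.
by rewrite -(enum_valK i) -(enum_valK j) -!/(f _) !const.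
Qed.

Lemma smith_factor_gt0 (i : 'I_#|V|.-1) : (0 < smith_factor m i)%N.
Proof.
rewrite lt0n absz_eq0; apply/negP => /eqP di0.
have [sd [A uA [B uB eM]]] := smith_diag_spec (laplacian m).
set d := smith_diag _ in di0 sd eM; set D := \matrix_(_, _) _ in eM.
have V0 : (#|V|.-1 < #|V|)%N.
  by rewrite ltn_predL (leq_trans _ (leq_pred _)) // (leq_ltn_trans _ (ltn_ord i)).
have lti : (i < #|V|)%N := ltn_trans (ltn_ord i) V0.
pose a := Ordinal lti; pose b := Ordinal V0.
have db0 : d`_b = 0.
  by apply/eqP; rewrite -dvd0z -[X in (X %| _)%Z]di0; apply: smith_diag_dvd; apply: ltnW.
pose x (k : 'I_#|V|) : 'rV[int]_#|V| := delta_mx 0 k *m invmx A.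
have xconst (k : 'I_#|V|) : d`_k = 0 -> forall j1 j2, x k 0 j1 = x k 0 j2.
  move=> dk0; apply: laplacian_kernel.
  rewrite eM /x !mulmxA mulmxKV // -rowE.
  suff -> : row k D = 0 by rewrite mul0mx.
  by apply/rowP=> j; rewrite !mxE dk0 mul0rn.
have xE (k : 'I_#|V|) : d`_k = 0 -> x k = const_mx (x k 0 a).
  by move=> dk0; apply/rowP => j; rewrite [RHS]mxE (xconst k dk0 j a).
have : x b 0 a *: x a = x a 0 a *: x b.
  apply/rowP=> j; rewrite [LHS]mxE [RHS]mxE.
  by rewrite (xconst a di0 j a) (xconst b db0 j a) mulrC.
move=> /(congr1 (mulmx^~ A)).
rewrite /= -!scalemxAl /x !mulmxKV // -!/(x _) => e.
have ab : (a == b) = false by apply/negbTE; rewrite neq_ltn /= ltn_ord.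
have xa0 : x a 0 a = 0.
  have /rowP/(_ b) := e; rewrite [LHS]mxE [RHS]mxE ['e_a _ _]mxE ['e_b _ _]mxE.
  by rewrite !eqxx eq_sym ab mulr0 mulr1 => /esym.
have : delta_mx 0 a = 0 :> 'rV[int]_#|V|.
  by rewrite -(mulmxKV uA (delta_mx 0 a)) -/(x a) (xE a di0) xa0 raddf0 mul0mx.
by move=> /rowP/(_ a); rewrite !mxE !eqxx.
Qed.

Lemma smith_diag_last : (0 < #|V|)%N -> (smith_diag (laplacian m))`_(#|V|.-1) = 0.
Proof.
move=> V_gt0; apply/eqP/negPn/negP => dn0.
have [sd [A uA [B uB eM]]] := smith_diag_spec (laplacian m).
set d := smith_diag _ in dn0 sd eM; set D := \matrix_(_, _) _ in eM.
have dj0 (j : 'I_#|V|) : d`_j != 0.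
  apply: contra dn0 => /eqP dj0; rewrite -dvd0z -[X in (X %| _)%Z]dj0.
  by apply: smith_diag_dvd; rewrite -ltnS prednK.
pose x : 'rV[int]_#|V| := const_mx 1.
have xL : x *m laplacian m = 0.
  apply/rowP=> j; rewrite !mxE (bigD1 j) //= !mxE eqxx mul1r.
  rewrite /degree (reindex (enum_val : 'I_#|V| -> V)) /=; last first.
    by exists enum_rank => ? _; rewrite (enum_rankK, enum_valK).
  rewrite (bigD1 j) //= m_loopless add0n (big_morph Posz PoszD (erefl _)).
  rewrite -big_split big1 //= => k /negPf kj.
  by rewrite !mxE kj mul1r m_sym subrr.
have yD : x *m A *m D = 0.
  by rewrite -(mulmxK uB (_ *m D)) -(mulmxA x A D) -(mulmxA x) -eM xL mul0mx.
have y0 : x *m A = 0.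
  apply/rowP=> j; have /rowP/(_ j) := yD.
  rewrite mxE (bigD1 j) //= big1 => [|k /negPf kj]; last first.
    by rewrite [D _ _]mxE (inj_eq val_inj) kj mulr0.
  rewrite addr0 [D _ _]mxE eqxx mulr1n [RHS]mxE => /eqP.
  by rewrite mulf_eq0 (negPf (dj0 j)) orbF [RHS]mxE => /eqP.
have : x = 0 by rewrite -(mulmxK uA x) y0 mul0mx.
by move=> /rowP/(_ (Ordinal V_gt0)); rewrite !mxE.
Qed.

End Connected.

Lemma cycle_graph_connected (n : nat) (i j : 'I_n) : connect (@cycle_graph n) i j.
Proof.
have csym : connect_sym (@cycle_graph n).
  by apply: sym_connect_sym => x y; rewrite /cycle_graph orbC.
case: n => [|n] in i j csym *; first by case: i.
suff c0 k : connect (@cycle_graph n.+1) ord0 k.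
  by rewrite (connect_trans _ (c0 j)) // csym.
case: k => k; elim: k => [|k IH] lt_k.
  by rewrite (_ : Ordinal _ = ord0) //; exact: val_inj.
apply: connect_trans (IH (ltnW lt_k)) (connect1 _).
apply/orP; left; apply/eqP/val_inj => /=.
by rewrite modn_small.
Qed.

Lemma cartesian_product_connected (V1 V2 : finType) (e1 : rel V1) (e2 : rel V2) :
  (forall u v, connect e1 u v) -> (forall u v, connect e2 u v) ->
  forall x y, connect (cartesian_product e1 e2) x y.
Proof.
move=> c1 c2 [x1 x2] [y1 y2]; apply: (@connect_trans _ _ (x1, y2)).
  have /connectP[p] := c2 x2 y2.
  elim: p x2 => [|z p IH] x2 /=; first by move=> _ ->.
  case/andP=> xz /IH{}IH /IH; apply: connect_trans; apply: connect1.
  by rewrite /cartesian_product /= eqxx xz.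
have /connectP[p] := c1 x1 y1.
elim: p x1 => [|z p IH] x1 /=; first by move=> _ ->.
case/andP=> xz /IH{}IH /IH; apply: connect_trans; apply: connect1.
by rewrite /cartesian_product /= eqxx xz orbT.
Qed.

Lemma cycle_graph_sym (n : nat) : symmetric (@cycle_graph n).
Proof. by move=> i j; rewrite /cycle_graph orbC. Qed.

Lemma cycle_graph_irr (n : nat) : (1 < n)%N -> irreflexive (@cycle_graph n).
Proof.
move=> n_gt1 i; rewrite /cycle_graph orbb; apply/negbTE/eqP => /(congr1 val) /=.
have [lt_n|le_n] := ltnP i.+1 n.
  by rewrite modn_small // => /eqP; rewrite ltn_eqF.
have ei : i.+1 = n by apply/eqP; rewrite eqn_leq ltn_ord.
by rewrite ei modnn => i0; rewrite -ei i0 in n_gt1.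
Qed.

Lemma torus_smith_factor_gt0 (n : nat) :
  (3 <= n)%N ->
  forall i : 'I_#|{: 'I_4 * 'I_n}|.-1, (0 < smith_factor
    (simple_mult (cartesian_product (@cycle_graph 4) (@cycle_graph n))) i)%N.
Proof.
move=> n_ge3; apply: smith_factor_gt0.
- move=> u v; rewrite /simple_mult /cartesian_product.
  by rewrite cycle_graph_sym (cycle_graph_sym v.1) (eq_sym u.1) (eq_sym u.2).
- move=> u; rewrite /simple_mult /cartesian_product.
  by rewrite !cycle_graph_irr ?andbF // ltnW.
- move=> u v; set e := cartesian_product _ _.
  rewrite (@eq_connect _ _ e); last by move=> x y; rewrite /simple_mult lt0b.
  by apply: cartesian_product_connected; exact: cycle_graph_connected.
Qed.

(* Main.v *)
(* Reducing the second coordinate modulo n1 is a regular covering of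
   C_4 x C_n2 onto C_4 x C_n1, and pulling functions back along any regular
   covering pi intertwines the two Laplacians, hence induces a map of critical
   groups. This map is injective: if the pullback of y is a Laplacian L2 f and g
   is a deck transformation, then f o g - f is harmonic, hence constant, and its
   sum over the vertices is zero, so f o g = f. Thus f descends to a function h
   with L1 h = y.
   With L = A D B a Smith decomposition, z |-> z B identifies the cokernel of D
   with that of L, so the pullback becomes a matrix between the cokernels of the
   diagonal matrices, whose torsion subgroups are the critical groups. *)
Require Import Defs.
From mathcomp Require Import all_boot all_order all_algebra all_fingroup.

Set Implicit Arguments.
Unset Strict Implicit.
Unset Printing Implicit Defensive.

Import Order.TTheory GRing.Theory Num.Theory.
Local Open Scope ring_scope.

(** * Row lattices through the Smith normal form *)

(** With [L = A D B], the equation [z B = w L] says [z = (w A) D], and [w A] is arbitrary because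
    [A] is invertible. Where the diagonal entry is 0, divisibility forces that entry of [z] to
    vanish. *)
Lemma smith_lattice (p : nat) (L : 'M[int]_p) :
  exists2 B, B \in unitmx & forall z : 'rV[int]_p,
    (exists w, z *m B = w *m L) <->
    (forall i, ((absz ((smith_diag L)`_i)%R)%:Z %| z 0%R i)%Z).
Proof.
have [_ [A uA [B uB eL]]] := smith_diag_spec L.
set D := \matrix_(i, j) _ in eL.
have mulD (w : 'rV_p) i : (w *m D) 0 i = w 0 i * (smith_diag L)`_i.
  rewrite mxE (bigD1 i) //= big1 => [|k /negPf ki].
    by rewrite addr0 [D _ _]mxE eqxx mulr1n.
  by rewrite [D _ _]mxE (inj_eq val_inj) ki mulr0.
exists B => // z; split=> [[w zBw] i|dvd_z].
  have -> : z = w *m A *m D.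
    by apply: (can_inj (mulmxK uB)); rewrite zBw eL !mulmxA.
  by rewrite mulD dvdzE absz_nat -dvdzE dvdz_mull.
pose y : 'rV_p := \row_i (z 0%R i %/ (smith_diag L)`_i)%Z.
exists (y *m invmx A); rewrite eL !mulmxA mulmxKV //; congr (_ *m _).
apply/rowP=> i; rewrite mulD mxE divzK //.
Qed.

(** * Residue classes of integers in [cyclic_group] *)

Definition int_mod (t : nat) (a : int) : cyclic_group t := inord `|(a %% t)%Z|.

Lemma val_int_mod (t : nat) (a : int) :
  (0 < t)%N -> (val (int_mod t a))%:Z = (a %% t)%Z.
Proof.
move=> t_gt0; have t_neq0 : t%:Z != 0 by rewrite eqz_nat -lt0n.
rewrite /= inordK ?gez0_abs ?modz_ge0 // prednK // -ltz_nat gez0_abs ?modz_ge0 //.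
exact: ltz_pmod.
Qed.

Lemma int_mod_eq (t : nat) (a b : int) :
  (0 < t)%N -> int_mod t a = int_mod t b <-> (t %| a - b)%Z.
Proof.
move=> t_gt0; rewrite -eqz_mod_dvd; split=> [e|/eqP e].
  by rewrite -!val_int_mod // e.
by apply: val_inj; apply/eqP; rewrite -eqz_nat !val_int_mod // e.
Qed.

Lemma val_cyclic_mul (t : nat) (x y : cyclic_group t) :
  (0 < t)%N -> val (x * y)%g = ((val x + val y) %% t)%N.
Proof. by case: t x y. Qed.

Lemma int_modD (t : nat) (a b : int) :
  (0 < t)%N -> int_mod t (a + b) = (int_mod t a * int_mod t b)%g.
Proof.
move=> t_gt0; apply: val_inj; apply/eqP; rewrite -eqz_nat val_int_mod //.
by rewrite val_cyclic_mul // -modz_nat PoszD !val_int_mod // modzDm.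
Qed.

Lemma int_mod_val (t : nat) (x : cyclic_group t) :
  (0 < t)%N -> int_mod t (val x) = x.
Proof.
move=> t_gt0; apply: val_inj; apply/eqP; rewrite -eqz_nat val_int_mod //.
by rewrite modz_nat modn_small // -[X in (_ < X)%N](prednK t_gt0) ltn_ord.
Qed.

(** * Embedding the torsion of one diagonal cokernel into another *)

Section LatticeEmbedding.

Variables (p q : nat) (t1 t2 : nat -> nat) (M : 'M[int]_(p.+1, q.+1)).
Hypothesis t1_gt0 : forall i, (i < p)%N -> (0 < t1 i)%N.
Hypotheses (t2_gt0 : forall i, (i < q)%N -> (0 < t2 i)%N) (t2_last : t2 q = 0%N).
Hypothesis M_lattice : forall z : 'rV[int]_p.+1,
  (forall i, (t1 i %| z 0%R i)%Z) <-> (forall k, (t2 k %| (z *m M) 0%R k)%Z).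

Let G1 : finGroupType := {dffun forall i : 'I_p, cyclic_group (t1 i)}.
Let G2 : finGroupType := {dffun forall k : 'I_q, cyclic_group (t2 k)}.

(** The coordinate that [G1] omits is set to 0, so that [image_last] applies to differences of
    representatives. *)
Let rep (x : G1) : 'rV[int]_p.+1 :=
  \row_i if unlift ord_max i is Some j then (val (x j))%:Z else 0.

Let rep_last (x : G1) : rep x 0 ord_max = 0.
Proof. by rewrite mxE unlift_none. Qed.

Let rep_lift (x : G1) (j : 'I_p) : rep x 0 (lift ord_max j) = val (x j).
Proof. by rewrite mxE liftK. Qed.

(* The vectors with zero last entry are those that are torsion modulo the
   first lattice, so M maps them to torsion vectors. *)
Let image_last (z : 'rV[int]_p.+1) : z 0 ord_max = 0 -> (z *m M) 0 ord_max = 0.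
Proof.
move=> z0; pose T := \prod_(i < p) (t1 i)%:Z.
have T0 : T != 0.
  by apply/prodf_neq0 => i _; rewrite eqz_nat -lt0n t1_gt0.
have lat i : (t1 i %| (T *: z) 0%R i)%Z.
  rewrite mxE; case: (unliftP ord_max i) => [j|] ->; last by rewrite z0 mulr0 dvdz0.
  by rewrite lift_max /T (bigD1 j) //= -mulrA dvdz_mulr.
have /(_ ord_max) := (M_lattice _).1 lat.
by rewrite t2_last dvd0z -scalemxAl mxE mulf_eq0 (negPf T0) => /eqP.
Qed.

Let rowB n (u v : 'rV[int]_n) i : (u - v) 0 i = u 0 i - v 0 i.
Proof. by rewrite !mxE. Qed.

Let rowD n (u v : 'rV[int]_n) i : (u + v) 0 i = u 0 i + v 0 i.
Proof. by rewrite mxE. Qed.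

(** Dropping the last coordinate loses nothing, since it is 0 by [image_last]. The forward half of
    [M_lattice] makes [f] a morphism, the converse makes it injective. *)
Let f (x : G1) : G2 :=
  [ffun k : 'I_q => int_mod (t2 k) ((rep x *m M) 0 (lift ord_max k))].

(** [rep (x * y)] and [rep x + rep y] differ only by multiples of the [t1 i], which [M] sends into
    the second lattice. *)
Let fM : {in [set: G1] &, {morph f : x y / (x * y)%g}}.
Proof.
move=> x y _ _; apply/ffunP => k; rewrite dffunM !ffunE -int_modD ?t2_gt0 //.
apply/int_mod_eq; first exact: t2_gt0.
have lat i : (t1 i %| (rep (x * y)%g - (rep x + rep y)) 0%R i)%Z.
  rewrite rowB rowD.
  case: (unliftP ord_max i) => [j|] ->; last by rewrite !rep_last.
  rewrite !rep_lift lift_max; apply/int_mod_eq; first exact: t1_gt0.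
  by rewrite int_modD ?t1_gt0 // !int_mod_val ?t1_gt0 // dffunM.
have := (M_lattice _).1 lat (lift ord_max k).
by rewrite mulmxBl mulmxDl lift_max rowB rowD.
Qed.

Let f_inj : injective f.
Proof.
move=> x y fxy; have lat k : (t2 k %| ((rep x - rep y) *m M) 0%R k)%Z.
  (* As [t2 q = 0], the last coordinate must vanish exactly, not just modulo something. *)
  case: (unliftP ord_max k) => [j|] ->; last first.
    by rewrite image_last ?dvdz0 // rowB !rep_last subr0.
  rewrite mulmxBl rowB lift_max.
  apply/int_mod_eq; first exact: t2_gt0.
  by move/ffunP/(_ j): fxy; rewrite !ffunE.
apply/ffunP => j; have := (M_lattice _).2 lat (lift ord_max j).
rewrite rowB !rep_lift lift_max.
by move/int_mod_eq; rewrite !int_mod_val ?t1_gt0 //; apply.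
Qed.

Lemma lattice_embedding_succ : exists H : {group G2}, isog [set: G1] H.
Proof.
exists (Morphism fM @* [set: G1])%G.
by apply/sub_isog => //; apply/injmP => x y _ _; apply: f_inj.
Qed.

End LatticeEmbedding.

(** The shape needed for critical groups, whose index type ['I_#|V|.-1] does not display [#|V|] as a
    successor. *)
Lemma lattice_embedding (p q : nat) (t1 t2 : nat -> nat) (M : 'M[int]_(p, q)) :
    (0 < p)%N -> (0 < q)%N ->
    (forall i, (i < p.-1)%N -> (0 < t1 i)%N) ->
    (forall i, (i < q.-1)%N -> (0 < t2 i)%N) -> t2 q.-1 = 0%N ->
    (forall z : 'rV[int]_p,
      (forall i, (t1 i %| z 0%R i)%Z) <-> (forall k, (t2 k %| (z *m M) 0%R k)%Z)) ->
  exists H : {group {dffun forall k : 'I_q.-1, cyclic_group (t2 k)}},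
    isog [set: {dffun forall i : 'I_p.-1, cyclic_group (t1 i)}] H.
Proof.
case: p q M => [|p] [|q] // M _ _ t1_gt0 t2_gt0 t2_last M_lattice.
exact: (lattice_embedding_succ t1_gt0 t2_gt0 t2_last M_lattice).
Qed.

(** * The Laplacian as an operator on functions *)

Definition lap (V : finType) (m : V -> V -> nat) (f : V -> int) (v : V) : int :=
  \sum_u (m u v)%:Z * (f v - f u).

Definition vertex_row (V : finType) (f : V -> int) : 'rV[int]_#|V| :=
  \row_i f (enum_val i).

Definition row_fun (V : finType) (x : 'rV[int]_#|V|) (u : V) : int :=
  x 0 (enum_rank u).

Lemma row_funK (V : finType) : cancel (@row_fun V) (@vertex_row V).
Proof. by move=> x; apply/rowP => i; rewrite mxE /row_fun enum_valK. Qed.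

Lemma vertex_rowK (V : finType) (f : V -> int) : row_fun (vertex_row f) =1 f.
Proof. by move=> u; rewrite /row_fun mxE enum_rankK. Qed.

Lemma eq_vertex_row (V : finType) (f g : V -> int) :
  f =1 g -> vertex_row f = vertex_row g.
Proof. by move=> fg; apply/rowP => i; rewrite !mxE fg. Qed.

Lemma sum_enum_val (V : finType) (F : V -> int) :
  \sum_(i < #|V|) F (enum_val i) = \sum_u F u.
Proof.
rewrite [RHS](reindex (enum_val : 'I_#|V| -> V)) //.
by exists enum_rank => ? _; rewrite (enum_rankK, enum_valK).
Qed.

Section LaplacianOperator.

Variables (V : finType) (m : V -> V -> nat).
Hypothesis m_sym : forall u v, m u v = m v u.
Hypothesis m_loopless : forall u, m u u = 0%N.

Lemma vertex_row_laplacian (f : V -> int) :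
  vertex_row f *m laplacian m = vertex_row (lap m f).
Proof.
apply/rowP => i; rewrite !mxE [RHS]/lap -[RHS]sum_enum_val (bigD1 i) //= !mxE eqxx.
rewrite [RHS](bigD1 i) //= m_loopless mul0r add0r.
under [RHS]eq_bigr do rewrite mulrBr.
rewrite sumrB mulrC; congr (_ + _).
  (* [degree] sums over the second argument of [m] and [lap] over the first; symmetry reconciles
     them. *)
  rewrite -mulr_suml /degree (big_morph Posz PoszD (erefl _)) -sum_enum_val.
  rewrite (bigD1 i) //= m_loopless add0r; congr (_ * _).
  by apply: eq_bigr => k _; rewrite m_sym.
rewrite -sumrN; apply: eq_bigr => k /negPf ki.
by rewrite !mxE ki mulrN mulrC.
Qed.

Hypothesis m_connected : forall u v, connect (fun x y => (0 < m x y)%N) u v.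

Lemma harmonic_constant (f : V -> int) :
  lap m f =1 (fun=> 0) -> forall u v, f u = f v.
Proof.
move=> f0 u v; have fL0 : vertex_row f *m laplacian m = 0.
  by rewrite vertex_row_laplacian (eq_vertex_row f0); apply/rowP => i; rewrite !mxE.
have := laplacian_kernel m_sym m_loopless m_connected fL0 (enum_rank u) (enum_rank v).
by rewrite !mxE !enum_rankK.
Qed.

Lemma sum_lap_automorphism (f : V -> int) (g : V -> V) :
    injective g -> (forall x y, m (g x) (g y) = m x y) ->
    (forall x, lap m f (g x) = lap m f x) ->
  forall x, f (g x) = f x.
Proof.
move=> g_inj gm f_inv x; pose h y := f (g y) - f y.
have h_const y : h y = h x.
  apply: harmonic_constant => z.
  have -> : lap m h z = lap m f (g z) - lap m f z.
    (* Substituting [g w] for the summation variable turns the Laplacian of [f] at [g z] into that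
       of [f] composed with [g] at [z]. *)
    rewrite [X in X - _](reindex_inj g_inj) -sumrB.
    apply: eq_bigr => w _; rewrite gm -mulrBr; congr (_ * _).
    by rewrite /h opprD addrACA -opprD.
  by rewrite f_inv subrr.
have : \sum_y h y = 0 by rewrite sumrB [X in _ - X](reindex_inj g_inj) subrr.
rewrite (eq_bigr (fun=> h x)) // sumr_const => /eqP.
(* The zero sum is [#|V|] times [h x], and [#|V|] is nonzero because [x] is a vertex. *)
rewrite mulrn_eq0 => /orP[|]; last by rewrite subr_eq0 => /eqP.
by move=> /eqP/card0_eq/(_ x).
Qed.

End LaplacianOperator.

(** * Regular coverings and critical groups *)

Section RegularCovering.

Variables (V1 V2 : finType) (m1 : V1 -> V1 -> nat) (m2 : V2 -> V2 -> nat).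
Hypothesis m1_sym : forall u v, m1 u v = m1 v u.
Hypothesis m1_loopless : forall u, m1 u u = 0%N.
Hypothesis m1_connected : forall u v, connect (fun x y => (0 < m1 x y)%N) u v.
Hypothesis m2_sym : forall u v, m2 u v = m2 v u.
Hypothesis m2_loopless : forall u, m2 u u = 0%N.
Hypothesis m2_connected : forall u v, connect (fun x y => (0 < m2 x y)%N) u v.

Variable pi : V2 -> V1.
Hypothesis pi_surj : forall w, exists u, pi u = w.
(** Local bijectivity in terms of multiplicities: edges at [v] into the fibre over [w] correspond to
    edges between [pi v] and [w]. Regularity is [pi_deck]: deck transformations are transitive on
    fibres. *)
Hypothesis pi_cover : forall w v, (\sum_(u | pi u == w) m2 u v)%N = m1 w (pi v).
Hypothesis pi_deck : forall u v, pi u = pi v -> exists g : V2 -> V2,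
  [/\ injective g, forall x y, m2 (g x) (g y) = m2 x y,
      forall x, pi (g x) = pi x & g u = v].

Definition pullback_mx : 'M[int]_(#|V1|, #|V2|) :=
  \matrix_(i, j) (enum_val i == pi (enum_val j))%:R.

Lemma vertex_row_pullback (f : V1 -> int) :
  vertex_row f *m pullback_mx = vertex_row (f \o pi).
Proof.
apply/rowP => j; rewrite !mxE /=.
rewrite (bigD1 (enum_rank (pi (enum_val j)))) //= !mxE enum_rankK eqxx mulr1.
rewrite big1 ?addr0 // => i; rewrite -(inj_eq enum_val_inj) enum_rankK => /negPf ij.
by rewrite !mxE ij mulr0.
Qed.

(** Group the neighbours of [v] by fibre: [f \o pi] is constant on each, and [pi_cover] counts the
    edges. *)
Lemma lap_pullback (f : V1 -> int) : lap m2 (f \o pi) =1 lap m1 f \o pi.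
Proof.
move=> v; rewrite /lap /= (partition_big pi xpredT) //=.
apply: eq_bigr => w _; rewrite -pi_cover (big_morph Posz PoszD (erefl _)) mulr_suml.
by apply: eq_bigr => u /eqP ->.
Qed.

Lemma lap_descent (f : V2 -> int) (y : V1 -> int) :
  lap m2 f =1 y \o pi -> exists g, y =1 lap m1 g.
Proof.
move=> fy; have fE u v : pi u = pi v -> f u = f v.
  case/pi_deck=> g [g_inj gm gpi <-]; apply/esym.
  have f_inv x : lap m2 f (g x) = lap m2 f x by rewrite !fy /= gpi.
  exact: (sum_lap_automorphism m2_sym m2_loopless m2_connected g_inj gm f_inv).
(* The choice within a fibre is immaterial by [fE], and [pi_surj] rules out the default 0. *)
pose g w := if [pick u | pi u == w] is Some u then f u else 0.
have gE : f =1 g \o pi.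
  move=> u; rewrite /g /=; case: pickP => [v /eqP/fE //|/(_ u)].
  by rewrite eqxx.
exists g => w; have [u <-] := pi_surj w.
rewrite -[y _]/((y \o pi) u) -fy -[RHS]/((lap m1 g \o pi) u) -lap_pullback.
by apply: eq_bigr => v _; rewrite !gE.
Qed.

Lemma critical_group_covering :
    (0 < #|V2|)%N ->
  exists H : {group critical_group m2}, isog [set: critical_group m1] H.
Proof.
move=> V2_gt0; have [B1 uB1 lat1] := smith_lattice (laplacian m1).
have [B2 uB2 lat2] := smith_lattice (laplacian m2).
have comm : laplacian m1 *m pullback_mx = pullback_mx *m laplacian m2.
  apply/row_matrixP => i; rewrite !rowE !mulmxA -(row_funK (delta_mx 0 i)).
  rewrite vertex_row_laplacian // !vertex_row_pullback vertex_row_laplacian //.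
  by apply: eq_vertex_row => v; rewrite lap_pullback.
apply: (@lattice_embedding _ _ (smith_factor m1) (smith_factor m2)
          (B1 *m pullback_mx *m invmx B2)) => //.
- by have /card_gt0P[v _] := V2_gt0; apply/card_gt0P; exists (pi v).
- move=> i lt_i.
  exact: (smith_factor_gt0 m1_sym m1_loopless m1_connected (Ordinal lt_i)).
- move=> i lt_i.
  exact: (smith_factor_gt0 m2_sym m2_loopless m2_connected (Ordinal lt_i)).
- by rewrite /smith_factor smith_diag_last.
move=> z; apply: (iff_trans (iff_sym (lat1 z))); apply: (iff_trans _ (lat2 _)).
(* In the original coordinates, [z B1] must lie in the row lattice of the first Laplacian iff its
   pullback lies in that of the second: [comm] gives one direction, [lap_descent] the other. *)
rewrite !mulmxA mulmxKV //; split=> -[w zw].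
  by exists (w *m pullback_mx); rewrite zw -!mulmxA comm.
have zw_fun : lap m2 (row_fun w) =1 row_fun (z *m B1) \o pi.
  move=> v; rewrite -[LHS]vertex_rowK -vertex_row_laplacian // row_funK -zw.
  by rewrite -(row_funK (z *m B1)) vertex_row_pullback row_funK vertex_rowK.
have [g zg] := lap_descent zw_fun.
exists (vertex_row g); rewrite vertex_row_laplacian //.
by rewrite -(row_funK (z *m B1)); apply: eq_vertex_row.
Qed.

End RegularCovering.

(** * Reduction modulo [n1] as a regular covering of cycles *)

Section TorusCovering.

Variables (n1 n2 : nat).
Hypotheses (n1_ge3 : (3 <= n1)%N) (n2_ge3 : (3 <= n2)%N) (n1_dvd : (n1 %| n2)%N).

Let n1_gt0 : (0 < n1)%N := ltnW (ltnW n1_ge3).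

Definition cycle_cover (x : 'I_n2) : 'I_n1 := Ordinal (ltn_pmod x n1_gt0).

Lemma cycle_cover_surj (i : 'I_n1) : exists x, cycle_cover x = i.
Proof.
have n2_gt0 : (0 < n2)%N := ltnW (ltnW n2_ge3).
exists (Ordinal (leq_trans (ltn_ord i) (dvdn_leq n2_gt0 n1_dvd))).
by apply: val_inj; rewrite /= modn_small.
Qed.

(** Wrapping around at [n2] is invisible modulo [n1], as [n1] divides [n2]. *)
Lemma cycle_cover_ordS (x : 'I_n2) : cycle_cover (ordS x) = ordS (cycle_cover x).
Proof. by apply: val_inj; rewrite /= modn_dvdm // -addn1 -modnDml addn1. Qed.

Lemma cycle_cover_ord_pred (x : 'I_n2) :
  cycle_cover (ord_pred x) = ord_pred (cycle_cover x).
Proof. by apply: ordS_inj; rewrite -cycle_cover_ordS !ord_predK. Qed.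

(** Equality would give [i + 2 = i] modulo [n], impossible for [n >= 3]. *)
Lemma ordS_neq_pred (n : nat) (i : 'I_n) : (3 <= n)%N -> ordS i != ord_pred i.
Proof.
move=> n_ge3; rewrite -(inj_eq (@ordS_inj n)) ord_predK; apply/eqP.
move=> /(congr1 val) /= /eqP; rewrite -addn1 modnDml addn1 -addn2.
rewrite -[X in _ == X](modn_small (ltn_ord i)) -[X in _ == X %[mod _]]addn0.
by rewrite eqn_modDl mod0n modn_small.
Qed.

(** The two neighbours are distinct, so the disjunction becomes a sum, which can be split over a
    fibre. *)
Lemma cycle_graphE (n : nat) (i j : 'I_n) : (3 <= n)%N ->
  (cycle_graph i j : nat) = ((i == ordS j) + (i == ord_pred j))%N.
Proof.
move=> n_ge3; rewrite /cycle_graph [j == _]eq_sym (can2_eq (@ordSK n) (@ord_predK n)).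
by case: eqP => [->|_]; rewrite ?addn0 // eq_sym (negPf (ordS_neq_pred j n_ge3)).
Qed.

Lemma cycle_cover_sum (i : 'I_n1) (y : 'I_n2) :
  (\sum_(x | cycle_cover x == i) cycle_graph x y)%N = cycle_graph i (cycle_cover y).
Proof.
rewrite (eq_bigr _ (fun x _ => cycle_graphE x y n2_ge3)) cycle_graphE // big_split.
have sum1 (z : 'I_n2) :
    (\sum_(x | cycle_cover x == i) (x == z))%N = (i == cycle_cover z).
  rewrite big_mkcond (bigD1 z) //= big1 => [|x /negPf->]; last by case: ifP.
  by rewrite eqxx addn0 eq_sym; case: eqP.
by rewrite /= !sum1 cycle_cover_ordS cycle_cover_ord_pred.
Qed.

Lemma cycle_graph_ordS (n : nat) (x y : 'I_n) :
  cycle_graph (ordS x) (ordS y) = cycle_graph x y.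
Proof. by rewrite /cycle_graph !(inj_eq (@ordS_inj n)). Qed.

Lemma val_iter_ordS (n k : nat) (x : 'I_n) :
  val (iter k (@ordS n) x) = ((x + k) %% n)%N.
Proof.
elim: k => [|k IH] /=; first by rewrite addn0 modn_small.
by rewrite [nat_of_ord _]IH -addn1 modnDml addn1 addnS.
Qed.

Lemma cycle_cover_deck (x y : 'I_n2) : cycle_cover x = cycle_cover y ->
  exists g : 'I_n2 -> 'I_n2,
  [/\ injective g, forall u v, cycle_graph (g u) (g v) = cycle_graph u v,
      forall u, cycle_cover (g u) = cycle_cover u & g x = y].
Proof.
(* Rotation by [y - x], with [n2] added to stay in the naturals. *)
move=> xy; pose k := (y + (n2 - x))%N; exists (iter k (@ordS n2)).
have k_dvd : (n1 %| k)%N.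
  have /eqP := congr1 val xy; rewrite /= eq_sym => yx.
  rewrite /dvdn /k -modnDml (eqP yx) modnDml subnKC ?(ltnW (ltn_ord x)) //.
split.
- by elim: (k) => [|j IH] u v //= /(@ordS_inj n2)/IH.
- by move=> u v; elim: (k) => [|j IH] //=; rewrite cycle_graph_ordS.
- move=> u; apply: val_inj; rewrite /= -[nat_of_ord _]/(val _).
  rewrite val_iter_ordS modn_dvdm //.
  by rewrite -modnDmr (eqP k_dvd) addn0.
apply: val_inj; rewrite val_iter_ordS /k addnCA subnKC ?(ltnW (ltn_ord x)) //.
by rewrite modnDr modn_small.
Qed.

End TorusCovering.

(** * Coverings of products with a fixed factor *)

Section CartesianProduct.

Variables (V W1 W2 : finType) (e : rel V) (e1 : rel W1) (e2 : rel W2) (rho : W2 -> W1).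
Hypothesis e_irr : irreflexive e.

Let pi (x : V * W2) : V * W1 := (x.1, rho x.2).

Lemma cartesian_cover_sum :
    (forall w y, (\sum_(x | rho x == w) e2 x y)%N = e1 w (rho y)) ->
  forall w v, (\sum_(u | pi u == w) simple_mult (cartesian_product e e2) u v)%N
     = simple_mult (cartesian_product e e1) w (pi v).
Proof.
move=> cover [a w] [b y]; rewrite /simple_mult /cartesian_product /=.
rewrite -(pair_big_dep (fun c => c == a) (fun c x => rho x == w)
  (fun c x => ((c == b) && e2 x y || e c b && (x == y) : nat))) /=.
(* If [a = b], irreflexivity of [e] leaves only edges along the second factor, counted by [cover];
   otherwise only [x = y] can contribute. *)
rewrite big_pred1_eq; case: eqP => [->|_] /=.
  by rewrite e_irr /= orbF -cover; apply: eq_bigr => x _; rewrite orbF.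
case: (e a b) => /=; last by rewrite big1.
rewrite big_mkcond (bigD1 y) //= big1 => [|x /negPf->]; last by case: ifP.
by rewrite eqxx addn0 eq_sym; case: eqP.
Qed.

Lemma cartesian_deck :
    (forall x y, rho x = rho y -> exists g : W2 -> W2,
      [/\ injective g, forall u v, e2 (g u) (g v) = e2 u v,
          forall u, rho (g u) = rho u & g x = y]) ->
  forall x y, pi x = pi y -> exists g : V * W2 -> V * W2,
    [/\ injective g,
        forall u v, simple_mult (cartesian_product e e2) (g u) (g v)
                    = simple_mult (cartesian_product e e2) u v,
        forall u, pi (g u) = pi u & g x = y].
Proof.
move=> deck [a x] [b y] [<- /deck[g [g_inj ge grho gx]]].
exists (fun u => (u.1, g u.2)); split=> /=.
- by move=> [c u] [d v] [-> /g_inj ->].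
- by move=> u v; rewrite /simple_mult /cartesian_product /= ge (inj_eq g_inj).
- by move=> u; rewrite /pi /= grho.
- by rewrite gx.
Qed.

End CartesianProduct.

(** * The graphs [C_4 x C_n] *)

Section TorusGraph.

Variable n : nat.
Hypothesis n_ge3 : (3 <= n)%N.

Let m := simple_mult (cartesian_product (@cycle_graph 4) (@cycle_graph n)).

Lemma torus_mult_sym u v : m u v = m v u.
Proof.
rewrite /m /simple_mult /cartesian_product.
by rewrite cycle_graph_sym (cycle_graph_sym v.1) (eq_sym u.1) (eq_sym u.2).
Qed.

Lemma torus_mult_loopless u : m u u = 0%N.
Proof.
by rewrite /m /simple_mult /cartesian_product !cycle_graph_irr ?andbF // ltnW.
Qed.

Lemma torus_connected u v : connect (fun x y => (0 < m x y)%N) u v.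
Proof.
set e := cartesian_product (@cycle_graph 4) (@cycle_graph n).
rewrite (@eq_connect _ _ e); last by move=> x y; rewrite /m /simple_mult lt0b.
by apply: cartesian_product_connected; apply: cycle_graph_connected.
Qed.

End TorusGraph.

Theorem theorem5p2 (n1 n2 : nat) (hn1 : (3 <= n1)%N) (hn2 : (3 <= n2)%N)
    (hdvd : (n1 %| n2)%N) :
  exists H : {group torus_critical_group n2},
    isog [set: torus_critical_group n1] H.
Proof.
apply: (@critical_group_covering _ _ _ _
  (@torus_mult_sym n1) (torus_mult_loopless hn1) (@torus_connected n1)
  (@torus_mult_sym n2) (torus_mult_loopless hn2) (@torus_connected n2)
  (fun x => (x.1, cycle_cover hn1 x.2))).
- by move=> [a i]; have [x <-] := cycle_cover_surj hn1 hn2 hdvd i; exists (a, x).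
- apply: cartesian_cover_sum; first exact: cycle_graph_irr.
  exact: cycle_cover_sum.
- exact/cartesian_deck/cycle_cover_deck.
- by rewrite card_prod !card_ord muln_gt0 (ltnW (ltnW hn2)).
Qed.
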